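(* There is a constant $c>0$ such that for every $n\ge 2$ and every graph $G$ on $n$ vertices, there is a CNF formula $F$ that encodes the independent-set property of $G$ and has $|F|\le c\, n^2/\log_2 n$ clauses; i.e., $|F| = O(n^2/\log n)$.
   Context: Formulas are CNF formulas (sets of clauses); $|F|$ is the number of clauses. For a formula $F$ and an assignment $\tau$ to some of its variables, $F|_\tau$ is obtained by deleting every clause satisfied by $\tau$ and deleting from the remaining clauses every literal falsified by $\tau$. Given a graph $G=(V,E)$, variables $X=\{x_v : v\in V\}$ and a (possibly empty) set $Y$ of auxiliary variables, a formula $F$ with variable set $X\cup Y$ encodes the independent-set property of $G$ if for every assignment $\tau: X\to\{\bot,\top\}$, $F|_\tau$ is satisfiable if and only if $\{v\in V : \tau(x_v)=\top\}$ is an independent set of $G$. *)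

(* Defs.v *)
From HB Require Import structures.
From mathcomp Require Import all_boot all_order all_algebra.
From mathcomp Require Import reals exp.

Set Implicit Arguments.
Unset Strict Implicit.
Unset Printing Implicit Defensive.

Import Order.TTheory GRing.Theory Num.Theory.

Section CNF.
Variable T : finType.

(* (x, true) is the positive literal x and (x, false) the negative one. *)
Definition literal : Type := (T * bool)%type.
Definition clause : Type := {set literal}.
Definition cnf : Type := {set clause}.

(* [None] marks a variable left unassigned. *)
Definition partial_assignment : Type := T -> option bool.

Definition lit_satisfied (tau : partial_assignment) (l : literal) : bool :=
  tau l.1 == Some l.2.

Definition lit_falsified (tau : partial_assignment) (l : literal) : bool :=
  tau l.1 == Some (~~ l.2).

Definition clause_satisfied (tau : partial_assignment) (C : clause) : bool :=
  [exists l in C, lit_satisfied tau l].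

Definition restrict (F : cnf) (tau : partial_assignment) : cnf :=
  [set [set l in C | ~~ lit_falsified tau l]
     | C : {set literal} in F & ~~ clause_satisfied tau C].

Definition satisfiable (F : cnf) : Prop :=
  exists sigma : T -> bool,
    forall C : clause, C \in F -> exists2 l : literal, l \in C & sigma l.1 = l.2.

End CNF.

Definition independent_set (V : finType) (e : rel V) (S : {set V}) : Prop :=
  forall u v : V, u \in S -> v \in S -> ~~ e u v.

(* The variables are V + Y: [inl v] is x_v and [inr y] is the auxiliary
   variable y.  An assignment of the x_v leaves every y unassigned. *)
Definition main_assignment (V Y : finType) (tau : V -> bool) :
    partial_assignment (V + Y)%type :=
  fun x => match x with inl v => Some (tau v) | inr _ => None end.

Definition encodes_independent_set (V : finType) (e : rel V) (Y : finType)
    (F : cnf (V + Y)%type) : Prop :=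
  forall tau : V -> bool,
    satisfiable (restrict F (main_assignment (Y:=Y) tau)) <->
    independent_set e [set v | tau v].

Definition log2 (R : realType) (x : R) : R := (ln x / ln 2%:R)%R.

(* Main.v *)
(** Cut the vertices into blocks of about (log n)/2 vertices.  A block B has
    only about sqrt n subsets T, so one can afford an auxiliary variable y_T for
    each of them, together with the clauses x_v -> y_T for v in T: this takes
    O(n^(3/2)) clauses.  All edges between a vertex u and B are then
    forbidden by the single clause ~ x_u \/ ~ y_(N(u) :&: B), and there are
    O(n^2 / log n) pairs (u, B). *)

Require Import Defs.
From mathcomp Require Import all_boot all_order all_algebra.
From mathcomp Require Import reals exp.
From mathcomp Require Import zify ring.

Set Implicit Arguments.
Unset Strict Implicit.
Unset Printing Implicit Defensive.

Import Order.TTheory GRing.Theory Num.Theory.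

(** Every literal on an [inl] variable is decided by [tau], so only the [inr] variables stay free.
    This lets the encoding be checked on the clauses of [F] themselves, without restriction. *)
Lemma satisfiable_restrict_main (V Y : finType) (F : cnf (V + Y)%type)
    (tau : V -> bool) :
  satisfiable (restrict F (main_assignment (Y:=Y) tau)) <->
  exists eta : Y -> bool, forall C, C \in F ->
    exists2 l, l \in C &
      match l.1 with inl v => tau v | inr y => eta y end = l.2.
Proof.
split=> [[sigma Fsigma]|[eta Feta]].
  exists (sigma \o inr) => C CF.
  have [/exists_inP[l lC]|nsatC] :=
    boolP (clause_satisfied (main_assignment (Y:=Y) tau) C).
    rewrite /lit_satisfied; case: l lC => -[v|y] b lC //= /eqP[tau_v].
    by exists (inl v, b).
  have [|l] := Fsigma [set l in C |
      ~~ lit_falsified (main_assignment (Y:=Y) tau) l].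
    by apply/imsetP; exists C; rewrite ?inE ?CF.
  rewrite inE => /andP[lC]; case: l lC => -[v|y] b lC.
    rewrite /lit_falsified /= => nf _; exists (inl v, b) => //=.
    by move: nf; case: (tau v); case: (b).
  by move=> _ sigma_y; exists (inr y, b).
exists (fun x => match x with inl v => tau v | inr y => eta y end) => D.
case/imsetP=> C /[!inE] /andP[CF _] ->.
have [l lC eq_l] := Feta C CF; exists l => //.
rewrite inE lC /lit_falsified /=.
by case: l lC eq_l => -[v|y] b lC //= ->; case: (b).
Qed.

Section BlockEncoding.
Variables (V : finType) (m : nat) (e : rel V) (g : V -> 'I_m).

Definition block (i : 'I_m) : {set V} := [set v | g v == i].

Definition up_clause (p : V * {set V}) : clause (V + {set V})%type :=
  [set (inl p.1, false); (inr p.2, true)].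

Definition edge_clause (p : V * 'I_m) : clause (V + {set V})%type :=
  [set (inl p.1, false); (inr [set v in block p.2 | e p.1 v], false)].

(** Taking all of [{set V}] as auxiliary variables is harmless because only clauses are counted; the
    up clauses are limited to subsets of a block. *)
Definition block_cnf : cnf (V + {set V})%type :=
  [set up_clause p | p in [set p : V * {set V} |
     (p.1 \in p.2) && (p.2 \subset block (g p.1))]]
  :|: [set edge_clause p | p in [set: V * 'I_m]].

Lemma block_cnf_encodes : encodes_independent_set e block_cnf.
Proof.
move=> tau; split=> [/satisfiable_restrict_main[eta Feta] u v|indep].
  rewrite !inE => tau_u tau_v; apply/negP => euv.
  (* For an edge uv inside the chosen set, x_v forces y_T for this T, while the edge clause of u and
     the block of v forbids it. *)
  pose T := [set w in block (g v) | e u w].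
  have vT : v \in T by rewrite !inE eqxx.
  have /Feta[l] : up_clause (v, T) \in block_cnf.
    apply/setUP; left; apply/imset_f; rewrite inE vT.
    by apply/subsetP => w; rewrite inE => /andP[].
  rewrite !inE => /orP[/eqP->|/eqP->]; rewrite /= ?tau_v // => eta_T.
  have /Feta[k] : edge_clause (u, g v) \in block_cnf.
    by apply/setUP; right; apply/imset_f; rewrite inE.
  by rewrite !inE => /orP[/eqP->|/eqP->]; rewrite /= ?tau_u // eta_T.
apply/satisfiable_restrict_main.
(* These are the least values that the up clauses allow. By independence, y_T is false whenever T
   consists of neighbours of a chosen u. *)
exists (fun T : {set V} => [exists v in T, tau v]) => C.
case/setUP=> /imsetP[[u T] /[!inE] /= H ->].
  have [tau_u|/negbTE tau_u] := boolP (tau u).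
    exists (inr T, true); rewrite ?inE ?eqxx ?orbT //=.
    by case/andP: H => uT _; apply/exists_inP; exists u.
  by exists (inl u, false); rewrite ?inE ?eqxx.
have [tau_u|/negbTE tau_u] := boolP (tau u); last first.
  by exists (inl u, false); rewrite ?inE ?eqxx.
exists (inr [set v in block T | e u v], false); rewrite ?inE ?eqxx ?orbT //=.
apply/negbTE/exists_inPn => v; rewrite inE => /andP[_ euv].
by apply/negP => tau_v; move: (indep u v); rewrite !inE euv; case/(_ _ _)/negP.
Qed.

Lemma card_block_cnf (k : nat) :
  (forall i, #|block i| <= k) -> #|block_cnf| <= #|V| * 2 ^ k + #|V| * m.
Proof.
move=> block_le; apply: leq_trans (leq_card_setU _ _) _; apply: leq_add.
  apply: leq_trans (leq_imset_card _ _) _.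
  apply: (@leq_trans (\sum_(v : V) #|powerset (block (g v))|)).
    rewrite -sum1_card (partition_big fst predT) //=.
    apply: leq_sum => v _; rewrite sum1_card.
    apply: leq_trans (leq_imset_card (pair v) _).
    apply/subset_leq_card/subsetP => -[w T].
    rewrite unfold_in inE /= => /andP[/andP[_ TB] /eqP <-].
    by apply/imset_f; rewrite inE.
  rewrite -sum_nat_const; apply: leq_sum => v _.
  by rewrite card_powerset leq_pexp2l.
apply: leq_trans (leq_imset_card _ _) _.
by rewrite cardsT card_prod card_ord.
Qed.

End BlockEncoding.

(** The enumeration of [V] is cut into consecutive runs of length [k], the last possibly incomplete,
    whence the successor. Within a run, the rank modulo [k] is injective. *)
Lemma equitable_blocks (V : finType) (k : nat) : 0 < k ->
  exists g : V -> 'I_(#|V| %/ k).+1, forall i, #|block g i| <= k.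
Proof.
move=> k_gt0; pose g (v : V) : 'I_(#|V| %/ k).+1 := inord (enum_rank v %/ k).
exists g => i.
have g_val v : g v = enum_rank v %/ k :> nat.
  by rewrite inordK // ltnS leq_div2r // ltnW.
pose h (v : V) : 'I_k := Ordinal (ltn_pmod (enum_rank v) k_gt0).
rewrite -[k in _ <= k]card_ord -(card_in_imset (f := h)) ?max_card //.
move=> u v; rewrite !inE => /eqP gu /eqP gv /(congr1 val)/= eq_mod.
apply/enum_rank_inj/val_inj => /=.
by rewrite (divn_eq (enum_rank u) k) (divn_eq (enum_rank v) k) eq_mod -!g_val gu gv.
Qed.

Lemma block_size_tradeoff (n : nat) (L := trunc_log 2 n) (k := L./2.+1) :
  0 < n -> (n * 2 ^ k + n * (n %/ k).+1) * L.+1 <= 10 * n ^ 2.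
Proof.
move=> n_gt0.
have L_le : L.+1 <= 2 * k by rewrite /k; lia.
have pow_L : 2 ^ L <= n by apply: trunc_logP.
(* With q = 2 ^ L./2, both L + 1 <= 2q and q^2 <= n hold, so the product is at most 2q * 2q <=
   4n. *)
have pow_k : 2 ^ k * L.+1 <= 4 * n.
  have h_le : (L./2).+1 <= 2 ^ L./2 by apply: ltn_expl.
  have : 2 ^ L./2 * 2 ^ L./2 <= n.
    by apply: leq_trans pow_L; rewrite -expnD leq_pexp2l //; lia.
  rewrite /k expnS; move: (2 ^ L./2) h_le L_le => q; rewrite /k; nia.
have div_k : n %/ k * L.+1 <= 2 * n.
  have := leq_trunc_div n k; nia.
have pow_gt0 : 0 < 2 ^ k by rewrite expn_gt0.
have L1_le : L.+1 <= 4 * n by apply: leq_trans pow_k; rewrite leq_pmull.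
rewrite (_ : _ * L.+1 =
  n * (2 ^ k * L.+1 + n %/ k * L.+1 + L.+1)); last by ring.
(* The three summands bound the up clauses, the edge clauses of [n %/ k] blocks, and those of the
   one extra block. *)
rewrite [10 * _](_ : _ = n * (4 * n + 2 * n + 4 * n)); last by ring.
by rewrite leq_mul2l !leq_add ?orbT.
Qed.

Lemma log2_le_trunc_log (R : realType) (n : nat) : 0 < n ->
  (log2 (n%:R : R) <= (trunc_log 2 n).+1%:R)%R.
Proof.
move=> n_gt0; rewrite /log2 ler_pdivrMr; last by rewrite ln_gt0 // ltr1n.
rewrite mulr_natl -lnXn ?ltr0n // -natrX ler_ln ?posrE ?ltr0n ?expn_gt0 //.
by rewrite ler_nat ltnW // trunc_log_ltn.
Qed.

Local Open Scope ring_scope.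

Theorem theorem10 (R : realType) :
  exists2 c : R, 0 < c &
    forall (n : nat) (V : finType) (e : rel V),
      (2 <= n)%N -> #|V| = n -> symmetric e -> irreflexive e ->
      exists (Y : finType) (F : cnf (V + Y)%type),
        encodes_independent_set e F /\
        #|F|%:R <= c * (n%:R ^+ 2 / log2 (n%:R : R)).
Proof.
exists 10%:R; first by rewrite ltr0n.
move=> n V e n_ge2 card_V _ _; subst n; set n := #|V|; have n_gt0 : (0 < n)%N by apply: ltnW.
have [g block_le] := equitable_blocks V (ltn0Sn (trunc_log 2 n)./2).
exists {set V}, (block_cnf e g); split; first exact: block_cnf_encodes.
have card_F := card_block_cnf e block_le.
have log_gt0 : 0 < log2 (n%:R : R) by apply: divr_gt0; apply: ln_gt0; rewrite ltr1n.
rewrite mulrA ler_pdivlMr //.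
(* Once the division is cleared, replacing the logarithm by a larger integer leaves an inequality
   between naturals. *)
apply: le_trans (ler_wpM2l (ler0n _ _) (log2_le_trunc_log R n_gt0)) _.
rewrite -natrX -!natrM ler_nat; apply: leq_trans (block_size_tradeoff n_gt0).
by rewrite leq_mul2r card_F orbT.
Qed.
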